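(* Let $\mathcal N$ be the set of renormalizable three-dimensional Hénon-like maps $F(w)=(f(x)-\varepsilon(w),\,x,\,\delta(w))$ which satisfy $$\partial_y\delta(F(w))+\partial_z\delta(F(w))\cdot\partial_x\delta(w)=0\qquad\text{for all } w\in\psi^1_v(B)\cup\psi^1_c(B).$$ Then the space $\mathcal I(\bar\varepsilon)\cap\mathcal N$ is invariant under renormalization: if $F\in\mathcal I(\bar\varepsilon)\cap\mathcal N$, then $RF\in\mathcal I(\bar\varepsilon)\cap\mathcal N$.
   Context: Points of $\mathbb R^3$ are written $w=(x,y,z)$. $B\subset\mathbb R^3$ is a cubic box. A (three-dimensional) Hénon-like map is a map $F$ with domain $B$, from $B$ to itself, of the form $F(w)=(f(x)-\varepsilon(w),\,x,\,\delta(w))$, where $f$ is a unimodal map of a closed interval $I$ (with $f(I)\subset I$, critical point and critical value in $I$) and $\varepsilon,\delta:B\to\mathbb R$ are sufficiently smooth with $\|\varepsilon\|,\|\delta\|\le\bar\varepsilon$ for a small $\bar\varepsilon>0$. The unimodal map $f$ is (period-doubling) renormalizable if there is a closed interval $J\ne I$ containing the critical point $c_f$, with $f^2(J)\subset J$ and $f^2(c_f)\in\partial J$; for the smallest such $J$, the renormalization of $f$ is the affine rescaling of $f^2|_J$ to $I$. For $F$ with renormalizable $f$ put $H(w)=(f(x)-\varepsilon(w),\,y,\,z-\delta(y,f^{-1}(y),0))$, where $f^{-1}$ is the inverse branch of $f$ with values near the critical value of $f$, and $RF=\Lambda\circ H\circ F^2\circ H^{-1}\circ\Lambda^{-1}$,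 where $\Lambda(w)=sw$ with the appropriate rescaling constant $s<-1$ coming from the one-dimensional renormalization of $f$. $F$ is renormalizable if this construction applies, $RF$ being again a Hénon-like map on $B$. Put $\psi^1_v=H^{-1}\circ\Lambda^{-1}$ and $\psi^1_c=F\circ\psi^1_v$. $\mathcal I(\bar\varepsilon)$ is the space of infinitely renormalizable Hénon-like maps with $\|\varepsilon\|,\|\delta\|=O(\bar\varepsilon)$; $\bar\varepsilon>0$ is assumed sufficiently small. For $RF$ the defining equation of $\mathcal N$ is the same equation with $F,\delta,\psi^1_v,\psi^1_c$ replaced by the corresponding objects for $RF$. *)

(* Defs.v *)
From HB Require Import structures.
From mathcomp Require Import all_boot all_order all_algebra.
From mathcomp Require Import all_classical all_reals all_analysis.

Set Implicit Arguments.
Unset Strict Implicit.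
Unset Printing Implicit Defensive.

Import Order.TTheory GRing.Theory Num.Theory.
Import numFieldNormedType.Exports.

Local Open Scope classical_set_scope.
Local Open Scope ring_scope.

Notation R3 R := (R^o * R^o * R^o)%type.

Section Smoothness.
Variable R : realType.

(* Coordinate-free form of "all partial derivatives up to order r exist and
   are continuous on the open set U". *)
Fixpoint smooth (V W : normedModType R) (r : nat) (U : set V) (g : V -> W) :
    Prop :=
  match r with
  | 0 => forall w, U w -> {for w, continuous g}
  | r'.+1 => (forall w, U w -> differentiable g w) /\
             (forall v : V, smooth r' U (fun w => 'D_v g w))
  end.

(* On a closed set K, being C^r means being C^r on some open neighbourhood.
   Maps with domain K are represented by total functions whose values away
   from K are irrelevant. *)
Definition smooth_on (V W : normedModType R) (r : nat) (K : set V)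
    (g : V -> W) : Prop :=
  exists U : set V, [/\ open U, K `<=` U & smooth r U g].

Definition vx : R3 R := (1, 0, 0).
Definition vy : R3 R := (0, 1, 0).
Definition vz : R3 R := (0, 0, 1).

Definition pdx (g : R3 R -> R^o) (w : R3 R) : R := 'D_vx g w.
Definition pdy (g : R3 R -> R^o) (w : R3 R) : R := 'D_vy g w.
Definition pdz (g : R3 R -> R^o) (w : R3 R) : R := 'D_vz g w.

Definition iter_pd (t : seq (R3 R)) (g : R3 R -> R^o) : R3 R -> R^o :=
  foldr (fun v h w => 'D_v h w) g t.

(* C^k norm: supremum over K of all iterated partial derivatives of order at
   most k; k = 0 is the sup norm. *)
Definition Cnorm (k : nat) (K : set (R3 R)) (g : R3 R -> R^o) : \bar R :=
  ereal_sup [set u | exists t w,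
    [/\ (size t <= k)%N, {subset t <= [:: vx; vy; vz]}, K w &
        u = (`|iter_pd t g w|)%:E]].

End Smoothness.

Section Henon.
Variable R : realType.

Record cube := Cube {
  cube_x : R; cube_y : R; cube_z : R;
  edge : R;
  edge_gt0 : 0 < edge }.

Definition sideX (B : cube) : set R := `[cube_x B, cube_x B + edge B]%classic.
Definition sideY (B : cube) : set R := `[cube_y B, cube_y B + edge B]%classic.
Definition sideZ (B : cube) : set R := `[cube_z B, cube_z B + edge B]%classic.

Definition box (B : cube) : set (R3 R) :=
  [set w | [/\ sideX B w.1.1, sideY B w.1.2 & sideZ B w.2]].

(* The turning point c may be a maximum or a minimum. *)
Definition unimodal (f : R -> R) (a b c : R) : Prop :=
  [/\ a < c < b,
      derive1 (f : R^o -> R^o) c = 0,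
      (forall x y, a <= x < c -> c < y <= b -> derive1 (f : R^o -> R^o) x * derive1 (f : R^o -> R^o) y < 0) &
      f @` `[a, b]%classic `<=` `[a, b]%classic].

Definition renorm_interval (f : R -> R) (a b c p q : R) : Prop :=
  [/\ p < q,
      `[p, q]%classic `<=` `[a, b]%classic /\ `[p, q]%classic <> `[a, b]%classic,
      p <= c <= q,
      (f \o f) @` `[p, q]%classic `<=` `[p, q]%classic &
      f (f c) = p \/ f (f c) = q].

Definition min_renorm_interval (f : R -> R) (a b c p q : R) : Prop :=
  renorm_interval f a b c p q /\
  (forall p' q', renorm_interval f a b c p' q' ->
     `[p, q]%classic `<=` `[p', q']%classic).

(* The splitting of the first coordinate of F into f and eps is not determined
   by the map F alone, whereas the construction of RF refers to f and to its
   interval I = [ilo, ihi]; hence f, I, eps and delta are all recorded. *)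
Record henon := Henon {
  hf : R -> R;
  ilo : R;
  ihi : R;
  heps : R3 R -> R^o;
  hdelta : R3 R -> R^o }.

Definition hmap (F : henon) (w : R3 R) : R3 R :=
  (hf F w.1.1 - heps F w, w.1.1, hdelta F w).

(* Henon-like maps on B, of class C^r, with the C^k norms of eps and delta at
   most eta. *)
Definition henon_like (B : cube) (r k : nat) (eta : R) (F : henon) : Prop :=
  [/\ [/\ smooth_on r (sideX B : set R^o) (hf F : R^o -> R^o),
          smooth_on r (box B) (heps F) &
          smooth_on r (box B) (hdelta F)],
      `[ilo F, ihi F]%classic `<=` sideX B,
      (exists c, unimodal (hf F) (ilo F) (ihi F) c),
      (Cnorm k (box B) (heps F) <= eta%:E)%E /\
      (Cnorm k (box B) (hdelta F) <= eta%:E)%E &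
      hmap F @` box B `<=` box B].

(* Data of one renormalization step: the scaling constant s, an interval
   V = [vlo, vhi] around the critical value of f, the inverse branch of f with
   values in V, and the inverse of H. *)
Record scheme := Scheme {
  scale : R;
  vlo : R;
  vhi : R;
  finv : R -> R;
  Hinv : R3 R -> R3 R }.

Definition Hmap (F : henon) (S : scheme) (w : R3 R) : R3 R :=
  (hf F w.1.1 - heps F w,
   w.1.2,
   w.2 - hdelta F (w.1.2, finv S w.1.2, 0)).

Definition Lambda (S : scheme) (w : R3 R) : R3 R := scale S *: w.
Definition LambdaV (S : scheme) (w : R3 R) : R3 R := (scale S)^-1 *: w.

Definition psi_v (S : scheme) : R3 R -> R3 R := Hinv S \o LambdaV S.
Definition psi_c (F : henon) (S : scheme) : R3 R -> R3 R := hmap F \o psi_v S.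

Definition Rmap (F : henon) (S : scheme) : R3 R -> R3 R :=
  Lambda S \o Hmap F S \o hmap F \o hmap F \o Hinv S \o LambdaV S.

(* The y-coordinates occurring in Lambda^-1(B), where f^-1 is needed. *)
Definition finv_dom (B : cube) (S : scheme) : set R :=
  [set t | sideY B (scale S * t)].

Definition Hdom (B : cube) (S : scheme) : set (R3 R) :=
  [set w | [/\ box B w, `[vlo S, vhi S]%classic w.1.1 & finv_dom B S w.1.2]].

(* The construction of RF applies.  Since V is an interval containing f(c) on
   which f' has no zero, finv is the inverse branch of f near the critical
   value, and is determined by f on its domain.  The constant s is the linear
   part of the orientation-reversing affine map from J = [p, q] onto I; it is
   automatically < -1. *)
Definition scheme_of (B : cube) (r : nat) (F : henon) (S : scheme) : Prop :=
  exists c p q : R,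
  [/\ unimodal (hf F) (ilo F) (ihi F) c,
      min_renorm_interval (hf F) (ilo F) (ihi F) c p q /\
      scale S = - ((ihi F - ilo F) / (q - p)),
      [/\ `[vlo S, vhi S]%classic `<=` sideX B,
          vlo S <= hf F c <= vhi S &
          forall x, vlo S <= x <= vhi S -> derive1 (hf F : R^o -> R^o) x != 0],
      [/\ smooth_on r (finv_dom B S : set R^o) (finv S : R^o -> R^o),
          (forall t, finv_dom B S t ->
             vlo S <= finv S t <= vhi S /\ hf F (finv S t) = t) &
          (forall t, finv_dom B S t -> box B (t, finv S t, 0))] &
      [/\ set_inj (Hdom B S) (Hmap F S),
          smooth_on r (LambdaV S @` box B) (Hinv S),
          (forall w, box B w -> Hdom B S (psi_v S w) /\
                                Hmap F S (psi_v S w) = LambdaV S w) &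
          (forall w, box B w -> Hdom B S (hmap F (psi_c F S w)))]].

(* G is the map RF for the scheme S, presented as a Henon-like map.  RF has to
   lie in the class that F comes from, with the same bound eta. *)
Definition renormalization (B : cube) (r k : nat) (eta : R)
    (F : henon) (S : scheme) (G : henon) : Prop :=
  [/\ scheme_of B r F S,
      henon_like B r k eta G &
      forall w, box B w -> hmap G w = Rmap F S w].

Definition renormalizable (B : cube) (r k : nat) (eta : R) : set henon :=
  [set F | henon_like B r k eta F /\
           exists S G, renormalization B r k eta F S G].

Definition infinitely_renormalizable (B : cube) (r k : nat) (eta : R) :
    set henon :=
  [set F | henon_like B r k eta F /\
     exists Fs : nat -> henon, Fs 0%N = F /\
       forall n, exists S, renormalization B r k eta (Fs n) S (Fs n.+1)].

Definition calN (B : cube) (r k : nat) (eta : R) : set henon :=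
  [set F | renormalizable B r k eta F /\
     forall S G, renormalization B r k eta F S G ->
     forall w, (psi_v S @` box B `|` psi_c F S @` box B) w ->
       pdy (hdelta F) (hmap F w)
       + pdz (hdelta F) (hmap F w) * pdx (hdelta F) w = 0].

End Henon.

(* Main.v *)
(* Write psi_v, psi_c for the two branches of F, s for the scaling constant and
   h(t) = delta(t, f^-1(t), 0).  On B the last coordinate of RF is
     delta_1(w) = s (delta(psi_c w) - h(x/s)),
     psi_c w = (x/s, (psi_v w)_x, delta(psi_v w)).
   The equation of N at psi_v w says that delta(psi_c w) does not depend, to
   first order, on the implicitly defined coordinate (psi_v w)_x, so
     d_x delta_1(w) = d_x delta(psi_c w) - h'(x/s),
     d_y delta_1(w) = d_z delta(psi_c w) (d_y delta(psi_v w) + d_z delta(psi_v w) h'(y/s)),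
     d_z delta_1(w) = d_z delta(psi_c w) d_z delta(psi_v w).
   Let w be a point of B and W = RF w, whose y-coordinate is the x-coordinate of
   w.  Then the terms in h' cancel in the equation of N for RF at w, whose left
   side becomes
     d_z delta(psi_c W) (d_y delta(psi_v W) + d_z delta(psi_v W) d_x delta(psi_c w)).
   Since psi_v W = F (psi_c w), the last factor is the left side of the equation
   of N for F at psi_c w. *)
Require Import Defs.
From mathcomp Require Import all_boot all_order all_algebra.
From mathcomp Require Import all_classical all_reals all_analysis.
From mathcomp Require Import ring lra.

Import Order.TTheory GRing.Theory Num.Theory.
Import numFieldNormedType.Exports.

Local Open Scope classical_set_scope.
Local Open Scope ring_scope.

(** * Differentials of functions whose values are prescribed on a closed set *)

Lemma smooth_on_differentiable (R : realType) (V W : normedModType R) (r : nat)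
    (K : set V) (g : V -> W) (w : V) :
  (1 <= r)%N -> smooth_on r K g -> K w -> differentiable g w.
Proof. by case: r => // r _ [U [_ KU [dg _]]] Kw; exact/dg/KU. Qed.

(* Only the values on [K] of total functions are prescribed; this determines
   their derivatives at boundary points of [K] too. *)
Lemma eq_diff_on (R : realType) (V W : normedModType R) (K : set V)
    (g h : V -> W) (w v : V) :
  differentiable g w -> differentiable h w -> K w ->
  (forall e : R, 0 < e ->
     exists t : R, [/\ t != 0, `|t| < e & K (t *: v + w)]) ->
  (forall x, K x -> g x = h x) -> 'd g w v = 'd h w v.
Proof.
move=> dg dh Kw accK gh; apply/eqP; rewrite -subr_eq0; apply/negPn/negP => L0.
have dgh : differentiable (g - h) w by exact: differentiableB.
(* A nonzero limit keeps the difference quotients of [g - h] nonzero for all small [t != 0], yet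
   they vanish whenever [t *: v + w] lies in [K]. *)
have /cvgr_neq0 : (fun t => t^-1 *: ((g - h) (t *: v + w) - (g - h) w)) @ 0^'
    --> 'd g w v - 'd h w v.
  have -> : 'd g w v - 'd h w v = 'D_v (g - h) w by rewrite deriveE // diffB.
  by have := @diff_derivable _ _ _ (g - h) w v dgh.
move=> /(_ L0) /nbhs_ballP [e /= e0 near_neq0].
have [t [t0 te Kt]] := accK e e0.
have := near_neq0 t; rewrite /ball /= sub0r normrN => /(_ te t0).
by rewrite !fctE (gh _ Kt) (gh _ Kw) !subrr scaler0 eqxx.
Qed.

Lemma is_diff_fst (R : realType) (U V W : normedModType R) (f df : U -> V * W)
    (x : U) :
  is_diff x f df -> is_diff x (fun y => (f y).1) (fun y => (df y).1).
Proof.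
move=> df_; apply: (@is_diff_comp _ _ _ _ f df fst fst).
apply: DiffDef; first by apply: linear_differentiable => q; exact: cvg_fst.
by rewrite diff_lin // => q; exact: cvg_fst.
Qed.

Lemma is_diff_snd (R : realType) (U V W : normedModType R) (f df : U -> V * W)
    (x : U) :
  is_diff x f df -> is_diff x (fun y => (f y).2) (fun y => (df y).2).
Proof.
move=> df_; apply: (@is_diff_comp _ _ _ _ f df snd snd).
apply: DiffDef; first by apply: linear_differentiable => q; exact: cvg_snd.
by rewrite diff_lin // => q; exact: cvg_snd.
Qed.

Lemma diff_R3 (R : realType) (g : R3 R -> R^o) (w v : R3 R) :
  differentiable g w ->
  'd g w v = v.1.1 * pdx g w + v.1.2 * pdy g w + v.2 * pdz g w.
Proof.
move=> dg; rewrite /pdx /pdy /pdz !deriveE //.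
have {1}-> : v = v.1.1 *: (vx R) + v.1.2 *: vy R + v.2 *: vz R.
  case: v => -[x y] z; rewrite /vx /vy /vz /=.
  by congr ((_, _), _); rewrite /= /GRing.scale /=; ring.
by rewrite !linearD !linearZ.
Qed.

(** * Short coordinate moves inside the box *)

Lemma interval_cluster (R : realType) (a l x e : R) :
  0 < l -> x \in `[a, a + l] -> 0 < e ->
  exists t : R, [/\ t != 0, `|t| < e & t + x \in `[a, a + l]].
Proof.
move=> l0; rewrite in_itv /= => /andP[ax xl] e0.
(* A move of at most half the length, towards the farther endpoint, stays in the interval. *)
pose t := Num.min e l / 2.
have t0 : 0 < t by rewrite divr_gt0 // lt_min e0.
have te : t < e.
  rewrite /t ltr_pdivrMr //; apply: (@le_lt_trans _ _ e); last by lra.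
  by rewrite ge_min lexx.
have tl : t <= l / 2 by rewrite ler_pM2r ?invr_gt0 // ge_min lexx orbT.
have [xm|xm] := leP x (a + l / 2).
  exists t; rewrite gt_eqF // gtr0_norm //; split=> //.
  by rewrite in_itv /=; apply/andP; split; lra.
exists (- t); rewrite oppr_eq0 gt_eqF // normrN gtr0_norm //; split=> //.
by rewrite in_itv /=; apply/andP; split; lra.
Qed.

(** Only one coordinate moves, so faces and corners are covered too; this supplies the accumulation
    hypothesis of [eq_diff_on]. *)
Lemma box_cluster (R : realType) (B : cube R) (w v : R3 R) (e : R) :
  box B w -> v \in [:: vx R; vy R; vz R] -> 0 < e ->
  exists t : R, [/\ t != 0, `|t| < e & box B (t *: v + w)].
Proof.
case: w => -[x y] z [/= Bx By Bz] vB e0.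
have E0 : forall t : R, t *: (0 : R^o) = 0 by move=> t; rewrite scaler0.
have E1 : forall t : R, t *: (1 : R^o) = t by move=> t; rewrite /GRing.scale /= mulr1.
move: vB; rewrite !inE => /or3P[] /eqP ->.
- have [t [t0 te Bt]] := interval_cluster _ _ _ _ _ (edge_gt0 B) Bx e0.
  by exists t; split=> //; split; rewrite /vx /= ?E0 ?E1 ?add0r.
- have [t [t0 te Bt]] := interval_cluster _ _ _ _ _ (edge_gt0 B) By e0.
  by exists t; split=> //; split; rewrite /vy /= ?E0 ?E1 ?add0r.
- have [t [t0 te Bt]] := interval_cluster _ _ _ _ _ (edge_gt0 B) Bz e0.
  by exists t; split=> //; split; rewrite /vz /= ?E0 ?E1 ?add0r.
Qed.

(* [p] is the derivative of the first coordinate of psi_v, [cx, cy, cz] and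
   [ax, ay, az] are the gradients of delta at psi_c w and psi_v w. *)
Lemma delta_chain_rule (K : fieldType) (s x y z p cx cy cz ax ay az h1 h2 : K) :
  s != 0 -> cy + cz * ax = 0 ->
  s * (s^-1 * x * cx + p * cy
       + (p * ax + s^-1 * y * ay + s^-1 * (z + h2) * az) * cz - s^-1 * h1)
  = cx * x - h1 + cz * (ay * y + az * (z + h2)).
Proof. by move=> s0 /eqP; rewrite addr_eq0 => /eqP ->; field. Qed.

(* [Defs.finv] is qualified because [fingraph.finv] shadows it. *)
Definition fiber_shift {R : realType} (F : henon R) (S : scheme R) (t : R^o) : R^o :=
  hdelta F (t, Defs.finv S t, 0).

(* A named constant, because unification diverges when it compares ['d] of
   different functions. *)
Definition fiber_shift_diff {R : realType} (F : henon R) (S : scheme R) (t x : R) : R :=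
  'd (fiber_shift F S) (t : R^o) (x : R^o).

(** * One renormalization step: coordinates and differentiability of the two branches *)

Section OneStep.
Context {R : realType} {B : cube R} {r k : nat} {eta : R}.
Context {F : henon R} {S : scheme R} {G : henon R}.
Hypotheses (hr : (1 <= r)%N) (FR : henon_like B r k eta F).
Hypothesis RFG : renormalization B r k eta F S G.

Local Notation s := (scale S).
Local Notation a := (psi_v S).
Local Notation c := (psi_c F S).
Local Notation delta := (hdelta F).
Local Notation shift := (fiber_shift F S).
Local Notation dshift := (fiber_shift_diff F S).

Lemma scale_neq0 : s != 0.
Proof.
case: RFG => -[c0 [p [q [[/andP[ac cb] _ _ _] [[[pq _ _ _ _] _] ->] _ _ _]]]] _ _.
by rewrite oppr_eq0 mulf_neq0 ?invr_neq0 ?subr_eq0 ?gt_eqF // (lt_trans ac).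
Qed.

Lemma psi_v_box w : box B w -> box B (a w).
Proof. by case: RFG => -[? [? [? [_ _ _ _ [_ _ H _]]]]] _ _ /H [[]]. Qed.

Lemma psi_v_y w : box B w -> (a w).1.2 = s^-1 * w.1.2.
Proof.
by case: RFG => -[? [? [? [_ _ _ _ [_ _ H _]]]]] _ _ /H [_ /(congr1 (snd \o fst)) /= ->].
Qed.

Lemma psi_v_z w : box B w -> (a w).2 = s^-1 * w.2 + shift (s^-1 * w.1.2).
Proof.
move=> Bw; case: RFG => -[? [? [? [_ _ _ _ [_ _ H _]]]]] _ _.
have [_ /(congr1 snd) /= Hz] := H _ Bw.
rewrite -[s^-1 * w.2]/(s^-1 *: w.2) -Hz.
by rewrite -psi_v_y // /fiber_shift subrK.
Qed.

(** [hmap F] and [Hmap F S] share their first coordinate, and [Hmap F S] takes [psi_v S w] to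
    [LambdaV S w]. *)
Lemma psi_c_x w : box B w -> (c w).1.1 = s^-1 * w.1.1.
Proof.
by case: RFG => -[? [? [? [_ _ _ _ [_ _ H _]]]]] _ _ /H [_ /(congr1 (fst \o fst)) /= ->].
Qed.

Lemma psi_c_box w : box B w -> box B (c w).
Proof. by move=> Bw; case: FR => _ _ _ _; apply; exists (a w) => //; exact: psi_v_box. Qed.

Lemma finv_dom_y w : box B w -> finv_dom B S (s^-1 * w.1.2).
Proof. by case: w => -[x y] z [/= _ By _]; rewrite /finv_dom /= mulVKf ?scale_neq0. Qed.

(* [finv_dom] is about the y-side of [B], whose x-side may be another interval;
   the point [x/s] is covered as the y-coordinate of [hmap F (psi_c F S w)]. *)
Lemma finv_dom_x w : box B w -> finv_dom B S (s^-1 * w.1.1).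
Proof.
move=> Bw; rewrite -psi_c_x //.
by case: RFG => -[? [? [? [_ _ _ _ [_ _ _ H]]]]] _ _; case: (H _ Bw).
Qed.

Lemma hdelta_renorm w : box B w ->
  hdelta G w = s * (delta (c w) - shift (s^-1 * w.1.1)).
Proof.
move=> Bw; case: RFG => _ _ /(_ _ Bw) /(congr1 snd) /=.
by rewrite -/(a w) -/(c w) -psi_c_x.
Qed.

(** Both points lie in [Hdom B S], where [Hmap F S] is injective, and it sends both to
    [LambdaV S (hmap G w)]. *)
Lemma psi_v_renorm w : box B w -> box B (hmap G w) ->
  a (hmap G w) = hmap F (c w).
Proof.
move=> Bw BGw; case: RFG => -[? [? [? [_ _ _ _ [inj _ H H']]]]] _ E.
have [D HE] := H _ BGw.
apply: inj; rewrite ?inE //; first exact: H'.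
rewrite HE E // /LambdaV /Rmap /Lambda /=.
by rewrite scalerA mulVf ?scale_neq0 // scale1r.
Qed.

Lemma differentiable_delta w : box B w -> differentiable delta w.
Proof. by case: FR => -[_ _ sd] _ _ _ _; exact: smooth_on_differentiable sd. Qed.

Lemma differentiable_hdelta_renorm w : box B w -> differentiable (hdelta G) w.
Proof.
by case: RFG => _ [[_ _ sd] _ _ _ _] _; exact: smooth_on_differentiable sd.
Qed.

Lemma differentiable_shift t : finv_dom B S t -> differentiable shift t.
Proof.
move=> Dt; case: RFG => -[? [? [? [_ _ _ [sfinv _ finvB] _]]]] _ _.
have dfinv := smooth_on_differentiable _ _ _ _ _ _ _ hr sfinv Dt.
apply: (differentiable_comp (f := fun t : R^o => (t, Defs.finv S t, 0) : R3 R)); last first.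
  exact/differentiable_delta/finvB.
apply: differentiable_pair => //.
by apply: differentiable_pair.
Qed.

Lemma differentiable_psi_v w : box B w -> differentiable a w.
Proof.
move=> Bw; case: RFG => -[? [? [? [_ _ _ _ [_ sH _ _]]]]] _ _.
apply: differentiable_comp; first exact: differentiableZ.
by apply: smooth_on_differentiable hr sH _; exists w.
Qed.

(** * Derivatives of [psi_v] and of the renormalized [delta] *)

Section Differentials.
Variables (w v : R3 R).
Hypotheses (Bw : box B w) (vB : v \in [:: vx R; vy R; vz R]).

Let acc (e : R) : 0 < e ->
  exists t : R, [/\ t != 0, `|t| < e & box B (t *: v + w)].
Proof. exact: box_cluster. Qed.

Let eq_diff (g h dg dh : R3 R -> R^o) :
  is_diff w g dg -> is_diff w h dh -> (forall x, box B x -> g x = h x) ->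
  dg v = dh v.
Proof.
move=> Hg Hh gh.
rewrite -(@diff_val _ _ _ _ _ _ _ Hg) -(@diff_val _ _ _ _ _ _ _ Hh).
by apply: eq_diff_on acc gh => //; exact: ex_diff.
Qed.

Let is_diff_psi_v : is_diff w a ('d a w).
Proof. exact/differentiableP/differentiable_psi_v. Qed.

Let is_diff_x : is_diff w (fun x : R3 R => s^-1 * x.1.1 : R^o) (fun x => s^-1 * x.1.1).
Proof. by apply: is_diffZ; do 2!apply: is_diff_fst; exact: is_diff_id. Qed.

Let is_diff_y : is_diff w (fun x : R3 R => s^-1 * x.1.2 : R^o) (fun x => s^-1 * x.1.2).
Proof. by apply: is_diffZ; apply/is_diff_snd/is_diff_fst; exact: is_diff_id. Qed.

Let is_diff_z : is_diff w (fun x : R3 R => s^-1 * x.2 : R^o) (fun x => s^-1 * x.2).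
Proof. by apply: is_diffZ; apply: is_diff_snd; exact: is_diff_id. Qed.

Lemma diff_psi_v_y : ('d a w v).1.2 = s^-1 * v.1.2.
Proof.
apply: (eq_diff _ _ (fun v => ('d a w v).1.2) _ _ is_diff_y psi_v_y).
by apply: is_diff_snd; exact: is_diff_fst.
Qed.

Lemma diff_psi_v_z :
  ('d a w v).2 = s^-1 * (v.2 + dshift (s^-1 * w.1.2) v.1.2).
Proof.
rewrite /fiber_shift_diff mulrDr -[X in _ = _ + X]linearZ.
apply: (eq_diff _ _ (fun v => ('d a w v).2)
  (fun v => s^-1 * v.2 + 'd shift (s^-1 * w.1.2 : R^o) (s^-1 * v.1.2)) _ _ psi_v_z).
  exact: is_diff_snd.
apply: (@is_diffD _ _ _ _ (fun x => shift (s^-1 * x.1.2)) _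
  (fun x => 'd shift (s^-1 * w.1.2 : R^o) (s^-1 * x.1.2)) _ is_diff_z).
apply: (@is_diff_comp _ _ _ _ _ _ shift _ _ is_diff_y).
exact/differentiableP/differentiable_shift/finv_dom_y.
Qed.

Lemma derive_hdelta_renorm :
  pdy delta (c w) + pdz delta (c w) * pdx delta (a w) = 0 ->
  'D_v (hdelta G) w =
    pdx delta (c w) * v.1.1 - dshift (s^-1 * w.1.1) v.1.1
    + pdz delta (c w) * (pdy delta (a w) * v.1.2 + pdz delta (a w) *
        (v.2 + dshift (s^-1 * w.1.2) v.1.2)).
Proof.
move=> Nw; have dG := differentiable_hdelta_renorm _ Bw.
(* This is [psi_c] on the box, with its first coordinate replaced by the linear [x/s], so that
   [hf F] and [heps F] need not be differentiated. *)
pose Phi x : R3 R := (s^-1 * x.1.1, (a x).1.1, delta (a x)).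
have cPhi x : box B x -> c x = Phi x.
  by move=> Bx; rewrite /Phi -psi_c_x.
have dPhi : is_diff w Phi
    (fun x => (s^-1 * x.1.1, ('d a w x).1.1, 'd delta (a w) ('d a w x))).
  apply: is_diff_pair.
    by apply: (is_diff_pair is_diff_x); exact/is_diff_fst/is_diff_fst.
  apply: (@is_diff_comp _ _ _ _ _ _ delta _ _ is_diff_psi_v).
  exact/differentiableP/differentiable_delta/psi_v_box.
rewrite deriveE //.
have -> : 'd (hdelta G) w v = s * ('d delta (c w)
      (s^-1 * v.1.1, ('d a w v).1.1, 'd delta (a w) ('d a w v))
    - s^-1 * dshift (s^-1 * w.1.1) v.1.1).
  rewrite /fiber_shift_diff -[X in _ - X]linearZ.
  apply: (eq_diff (hdelta G)
    (fun x => s * (delta (Phi x) - shift (s^-1 * x.1.1))) ('d (hdelta G) w)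
    (fun x => s * ('d delta (c w)
         (s^-1 * x.1.1, ('d a w x).1.1, 'd delta (a w) ('d a w x))
       - 'd shift (s^-1 * w.1.1 : R^o) (s^-1 * x.1.1)))).
  - exact: differentiableP.
  - apply: is_diffZ.
    apply: (@is_diffB _ _ _ (delta \o Phi) (fun x => shift (s^-1 * x.1.1))
        (fun x => 'd delta (c w)
           (s^-1 * x.1.1, ('d a w x).1.1, 'd delta (a w) ('d a w x)))
        (fun x => 'd shift (s^-1 * w.1.1 : R^o) (s^-1 * x.1.1))).
      apply: (@is_diff_comp _ _ _ _ _ _ delta _ _ dPhi).
      by rewrite -cPhi //; exact/differentiableP/differentiable_delta/psi_c_box.
    apply: (@is_diff_comp _ _ _ _ _ _ shift _ _ is_diff_x).
    exact/differentiableP/differentiable_shift/finv_dom_x.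
  - by move=> x Bx; rewrite hdelta_renorm // cPhi.
rewrite diff_R3 /=; last exact/differentiable_delta/psi_c_box.
rewrite diff_R3; last exact/differentiable_delta/psi_v_box.
rewrite diff_psi_v_y diff_psi_v_z.
(* [Nw] removes [('d a w v).1.1], the component for which there is no explicit formula. *)
apply: delta_chain_rule Nw; exact: scale_neq0.
Qed.

End Differentials.

(** * The equation of N passes to the renormalized map *)

Lemma calN_renorm_point w : box B w -> box B (hmap G w) ->
  (forall x, (a @` box B `|` c @` box B) x ->
     pdy delta (hmap F x) + pdz delta (hmap F x) * pdx delta x = 0) ->
  pdy (hdelta G) (hmap G w) + pdz (hdelta G) (hmap G w) * pdx (hdelta G) w = 0.
Proof.
move=> Bw BGw NF.
have Na x : box B x -> pdy delta (c x) + pdz delta (c x) * pdx delta (a x) = 0.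
  by move=> Bx; apply: NF; left; exists x.
have Nc : pdy delta (a (hmap G w)) + pdz delta (a (hmap G w)) * pdx delta (c w) = 0.
  by rewrite psi_v_renorm //; apply: NF; right; exists w.
have dshift0 t : dshift t 0 = 0 by exact: linear0.
(* The y-coordinate of [hmap G w] is the x-coordinate of [w], so the same [m] enters [Gy] with a
   plus and [Gx] with a minus sign. *)
set m := dshift (s^-1 * w.1.1) 1.
have Gy : pdy (hdelta G) (hmap G w) = pdz delta (c (hmap G w)) *
    (pdy delta (a (hmap G w)) + pdz delta (a (hmap G w)) * m).
  rewrite /pdy derive_hdelta_renorm ?inE ?eqxx ?orbT //; last exact: Na.
  by rewrite /vy /= dshift0 mulr0 subr0 mulr1 !add0r.
have Gz : pdz (hdelta G) (hmap G w) =
    pdz delta (c (hmap G w)) * pdz delta (a (hmap G w)).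
  rewrite /pdz derive_hdelta_renorm ?inE ?eqxx ?orbT //; last exact: Na.
  by rewrite /vz /= !dshift0 !mulr0 subr0 addr0 mulr1 !add0r.
have Gx : pdx (hdelta G) w = pdx delta (c w) - m.
  rewrite /pdx derive_hdelta_renorm ?inE ?eqxx ?orbT //; last exact: Na.
  by rewrite /vx /= !dshift0 mulr1 addr0 !mulr0 addr0 mulr0 addr0.
rewrite Gx Gy Gz -[RHS](mulr0 (pdz delta (c (hmap G w)))) -Nc.
ring.
Qed.

End OneStep.

Theorem theorem3p5 (R : realType) (B : cube R) (r k : nat)
    (hr : (1 <= r)%N) (hk : (k <= r)%N) (C : R) (hC : 0 < C) :
  exists2 e0 : R, 0 < e0 &
    forall e : R, 0 < e <= e0 ->
    let I := infinitely_renormalizable B r k (C * e) in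
    let N := calN B r k (C * e) in
    forall F : henon R, (I `&` N) F ->
      (exists S G, renormalization B r k (C * e) F S G /\ (I `&` N) G) /\
      (forall S G, renormalization B r k (C * e) F S G ->
         renormalizable B r k (C * e) G -> N G).
Proof.
exists 1 => // e _ I N F [[FR [Fs [Fs0 RFs]]] [_ NF]].
have NR S G : renormalization B r k (C * e) F S G ->
    renormalizable B r k (C * e) G -> N G.
  move=> RFG RG; split=> // S' G' RGG' w ww.
  have GR : henon_like B r k (C * e) G by case: RG.
  have Bw : box B w.
    by case: ww => -[x Bx <-]; [exact: (psi_v_box RGG')|exact: (psi_c_box GR RGG')].
  apply: (calN_renorm_point hr FR RFG) => //; last exact: NF RFG.
  by case: GR => _ _ _ _; apply; exists w.
(* The witness is the second map of the sequence of [F]: the shifted sequence puts it in [I], and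
   the third map makes it renormalizable, as [NR] requires. *)
split=> //; have [S RFG] := RFs 0%N; rewrite Fs0 in RFG.
have GR : henon_like B r k (C * e) (Fs 1%N) by case: RFG.
exists S, (Fs 1%N); split=> //; split.
  by split=> //; exists (fun n => Fs n.+1); split=> // n; exact: RFs.
apply: NR RFG _; split=> //.
by have [S' RG] := RFs 1%N; exists S', (Fs 2).
Qed.
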